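(* There is an absolute constant $C>0$ such that for every finite undirected graph $G=(V,E,w)$ with $n=|V|$ and every integer $k$ with $2\le k\le n$ and $\lambda_k>0$, $$\phi(G)\le C\,k\,\frac{\lambda_2}{\sqrt{\lambda_k}}.$$
   Context: $G=(V,E,w)$ is a finite undirected graph with positive edge weights $w:E\to(0,\infty)$. The weighted degree of $v$ is $w(v)=\sum_{u\sim v}w(u,v)$; it is assumed that $w(v)\ge 1$ for all $v$. For $S\subseteq V$, $\mathrm{vol}(S)=\sum_{v\in S}w(v)$, $\overline S=V\setminus S$, and $w(E(S,\overline S))$ is the total weight of edges with exactly one endpoint in $S$. The conductance of $\emptyset\ne S\subsetneq V$ is $\phi(S)=w(E(S,\overline S))/\min\{\mathrm{vol}(S),\mathrm{vol}(\overline S)\}$, and $\phi(G)=\min_{\emptyset\ne S\subsetneq V}\phi(S)$. Let $A$ be the weighted adjacency matrix, $D$ the diagonal matrix of weighted degrees, and $\mathcal L=I-D^{-1/2}AD^{-1/2}$ the normalized Laplacian, with eigenvalues $0=\lambda_1\le\lambda_2\le\dots\le\lambda_n\le 2$. *)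

(* Defs.v *)
From HB Require Import structures.
From mathcomp Require Import all_boot all_order all_algebra.
Set Implicit Arguments. Unset Strict Implicit. Unset Printing Implicit Defensive.
Import Order.TTheory GRing.Theory Num.Theory.
Local Open Scope ring_scope.

(* A weighted undirected graph on vertex set 'I_n is given by a weight
   function w : 'I_n -> 'I_n -> R; {u,v} is an edge iff w u v > 0. *)
Definition is_wgraph (R : realDomainType) (n : nat) (w : 'I_n -> 'I_n -> R) : Prop :=
  (forall i j, w i j = w j i) /\ (forall i j, 0 <= w i j) /\ (forall i, w i i = 0).

Definition wdeg (R : realDomainType) n (w : 'I_n -> 'I_n -> R) (v : 'I_n) : R :=
  \sum_(u < n) w v u.

Definition vol (R : realDomainType) n (w : 'I_n -> 'I_n -> R) (S : {set 'I_n}) : R :=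
  \sum_(v in S) wdeg w v.

Definition cutw (R : realDomainType) n (w : 'I_n -> 'I_n -> R) (S : {set 'I_n}) : R :=
  \sum_(u in S) \sum_(v in ~: S) w u v.

Definition conductance (R : realFieldType) n (w : 'I_n -> 'I_n -> R) (S : {set 'I_n}) : R :=
  cutw w S / Num.min (vol w S) (vol w (~: S)).

(* phi(G) = min over nonempty proper S of phi(S).  The neutral element 1 is
   harmless: phi(S) <= 1 always holds (cut <= vol of either side). *)
Definition graph_conductance (R : realFieldType) n (w : 'I_n -> 'I_n -> R) : R :=
  \big[Num.min/1]_(S : {set 'I_n} | (S != set0) && (S != setT)) conductance w S.

Definition adjmx (R : realDomainType) n (w : 'I_n -> 'I_n -> R) : 'M[R]_n :=
  \matrix_(i, j) w i j.

Definition degmx_invsqrt (R : rcfType) n (w : 'I_n -> 'I_n -> R) : 'M[R]_n :=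
  diag_mx (\row_i (Num.sqrt (wdeg w i))^-1).

Definition nlaplacian (R : rcfType) n (w : 'I_n -> 'I_n -> R) : 'M[R]_n :=
  1%:M - degmx_invsqrt w *m adjmx w *m degmx_invsqrt w.

Definition sorted_spectrum (R : rcfType) n (M : 'M[R]_n) (s : seq R) : Prop :=
  sorted <=%R s /\ char_poly M = \prod_(x <- s) ('X - x%:P).

(* Main.v *)
(* Following Kwok, Lau, Lee, Oveis Gharan and Trevisan. Cutting a vector orthogonal to
   the constants at its weighted median gives a nonnegative function f supported on at
   most half of the volume, with Rayleigh quotient at most lambda_2. Choose thresholds on
   the range of f greedily: either 2k of them can be placed so that the tents over
   consecutive intervals, composed with f, all have mass at least C, or the distance mu
   from f to a set of O(k) thresholds has total square O(k C). For C a suitable multiple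
   of lambda_2 / (k lambda_k) the first case is impossible: k of these disjointly
   supported functions would have Rayleigh quotient below lambda_k / 2. In the second
   case the primitive h of mu satisfies f^2 <= O(k) h(f) by Cauchy-Schwarz, while
   |h(f u) - h(f v)| <= |f u - f v| (mu(f u) + |f u - f v|); hence the coarea inequality
   for h(f) bounds phi by O(k) lambda_2 / sqrt lambda_k. *)

Require Import Defs.
From HB Require Import structures.
From mathcomp Require Import all_boot all_order all_algebra.
From mathcomp Require Import ring lra.
Set Implicit Arguments.
Unset Strict Implicit.
Unset Printing Implicit Defensive.
Import Order.TTheory GRing.Theory Num.Theory.
Local Open Scope ring_scope.

(** * Spectral theorem for symmetric matrices over a real closed field *)

Lemma char_poly_similar (R : comUnitRingType) (n : nat) (Q M : 'M[R]_n) :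
  Q \in unitmx -> char_poly (Q *m M *m invmx Q) = char_poly M.
Proof.
move=> Qu; set q := map_mx polyC Q; set q' := map_mx polyC (invmx Q).
have qq' : q *m q' = 1%:M by rewrite -map_mxM mulmxV // map_mx1.
rewrite /char_poly /char_poly_mx !map_mxM -/q -/q'.
have -> : 'X%:M - q *m map_mx polyC M *m q' = q *m ('X%:M - map_mx polyC M) *m q'.
  rewrite mulmxBr mulmxBl; congr (_ - _).
  by rewrite scalar_mxC -mulmxA qq' mulmx1.
rewrite !det_mulmx mulrAC -det_mulmx qq' det1; exact: mul1r.
Qed.

Lemma char_poly_block_diag (R : comNzRingType) (m n : nat) (A : 'M[R]_m) (B : 'M[R]_n) :
  char_poly (block_mx A 0 0 B) = char_poly A * char_poly B.
Proof.
rewrite /char_poly /char_poly_mx map_block_mx !map_mx0 scalar_mx_block.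
by rewrite opp_block_mx add_block_mx !oppr0 !addr0 det_ublock.
Qed.

Lemma mulmx_row_tr (R : comNzRingType) (n : nat) (x y : 'rV[R]_n) :
  x *m y^T = (\sum_j x 0 j * y 0 j)%:M.
Proof.
apply/matrixP => i j; rewrite !ord1 [RHS]mxE [LHS]mxE mulr1n.
by apply: eq_bigr => k _; rewrite mxE.
Qed.

Lemma row_sqr_gt0 (R : realDomainType) (n : nat) (x : 'rV[R]_n) :
  x != 0 -> 0 < \sum_j x 0 j ^+ 2.
Proof.
move=> x_neq0; rewrite lt_def sumr_ge0 ?andbT => [|i _]; last exact: sqr_ge0.
apply: contraNneq x_neq0 => /eqP; rewrite psumr_eq0 => [/allP s0|i _]; last exact: sqr_ge0.
apply/eqP/rowP => j; rewrite [RHS]mxE; apply/eqP.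
by rewrite -sqrf_eq0; apply: s0 (mem_index_enum j).
Qed.

Lemma scalar_mx1_inj (R : nzRingType) : injective (@scalar_mx R 1).
Proof. by move=> a b /matrixP/(_ 0 0); rewrite !mxE !mulr1n. Qed.

(* The reflection exchanging v and the first basis vector. *)
Lemma householder (R : realFieldType) (n : nat) (v : 'rV[R]_(1 + n)) :
  v *m v^T = 1%:M -> exists Q : 'M[R]_(1 + n), Q *m Q^T = 1%:M /\ delta_mx 0 0 *m Q = v.
Proof.
move=> v1; set e : 'rV[R]_(1 + n) := delta_mx 0 0.
have [->|neq_ve] := eqVneq v e.
  by exists 1%:M; rewrite trmx1 !mulmx1.
pose u := e - v.
have u_neq0 : u != 0 by rewrite subr_eq0 eq_sym.
have ev : e *m v^T = (v 0 0)%:M.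
  apply/matrixP => i j; rewrite !ord1 !mxE /= (bigD1 0) //= big1 => [|k /negPf k0].
    by rewrite !mxE !eqxx /= mul1r addr0 mulr1n.
  by rewrite !mxE k0 andbF mul0r.
have ve : v *m e^T = (v 0 0)%:M by apply: trmx_inj; rewrite trmx_mul trmxK ev tr_scalar_mx.
have ee : e *m e^T = 1%:M.
  apply/matrixP => i j; rewrite !ord1 !mxE /= (bigD1 0) //= big1 => [|k /negPf k0].
    by rewrite !mxE !eqxx /= mul1r addr0.
  by rewrite !mxE k0 andbF mul0r.
have uu : u *m u^T = (2 * (1 - v 0 0))%:M.
  rewrite linearB /= mulmxBl !mulmxBr ev ve ee v1.
  by rewrite -!raddfB /=; congr (_%:M); ring.
have eu : e *m u^T = (1 - v 0 0)%:M by rewrite linearB /= mulmxBr ee ev -raddfB.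
have v0_neq1 : 1 - v 0 0 != 0.
  have := row_sqr_gt0 u_neq0; under eq_bigr do rewrite expr2.
  rewrite -(scalar_mx1_inj (etrans (esym uu) (mulmx_row_tr u u))).
  by apply: contraTneq => ->; rewrite mulr0 ltxx.
have uE : u = e - v by [].
clearbody u; set c := (1 - v 0 0)^-1.
(* The squared norm of [u] is [2 / c], so this is the usual reflection along [u]. *)
exists (1%:M - c *: (u^T *m u)); split.
  have -> : (1%:M - c *: (u^T *m u))^T = 1%:M - c *: (u^T *m u).
    by rewrite linearB linearZ /= trmx_mul trmxK trmx1.
  rewrite mulmxBl !mulmxBr !mul1mx mulmx1 -scalemxAl -scalemxAr scalerA.
  rewrite !mulmxA -(mulmxA u^T u) uu mul_mx_scalar -scalemxAl scalerA.
  rewrite opprB -[RHS]addr0 -addrA; congr (_ + _).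
  rewrite -scaleNr -!scalerDl.
  have -> : - c + (c * c * (2 * (1 - v 0 0)) - c) = 0 by rewrite /c; field.
  by rewrite scale0r.
rewrite mulmxBr mulmx1 -scalemxAr mulmxA eu mul_scalar_mx scalerA mulVf // scale1r.
by rewrite uE subKr.
Qed.

(** Deflation: the head of [s] is an eigenvalue, a reflection moves a unit eigenvector to the first
    basis vector, and by symmetry the conjugated matrix splits off a block of size 1. Removing
    eigenvalues in the order of [s] makes the diagonal [s] itself. *)
Lemma symmetric_spectral (R : rcfType) (n : nat) (M : 'M[R]_n) (s : seq R) :
  M^T = M -> char_poly M = \prod_(x <- s) ('X - x%:P) ->
  exists P : 'M[R]_n, P *m P^T = 1%:M /\ M = P^T *m diag_mx (\row_i s`_i) *m P.
Proof.
elim: n M s => [|n IH] M s symM chM.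
  by exists 1%:M; split; apply/matrixP; case.
have sz_s : size s = n.+1.
  by have := size_char_poly M; rewrite chM (size_prod_XsubC s id) => -[].
case: s sz_s chM => [//|a s] _; rewrite big_cons => chM.
have : eigenvalue M a.
  by rewrite eigenvalue_root_char chM rootM root_XsubC eqxx.
case/eigenvalueP => x xM x_neq0.
have r_gt0 := row_sqr_gt0 x_neq0.
set r := \sum_j _ in r_gt0.
have nx : x *m x^T = r%:M.
  by rewrite mulmx_row_tr; congr (_%:M); apply: eq_bigr => j _; rewrite expr2.
have [|Q [QQ eQ]] := @householder R n ((Num.sqrt r)^-1 *: x).
  rewrite linearZ /= -scalemxAl -scalemxAr scalerA nx scale_scalar_mx.
  rewrite -invfM -expr2 sqr_sqrtr ?ltW // mulVf //; exact: lt0r_neq0.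
set v := _ *: x in eQ.
have vM : v *m M = a *: v by rewrite -scalemxAl xM scalerA mulrC -scalerA.
have Qu : Q \in unitmx by case/mulmx1_unit: QQ.
have QV : invmx Q = Q^T by rewrite -[RHS]mul1mx -(mulVmx Qu) -mulmxA QQ mulmx1.
have QtQ : Q^T *m Q = 1%:M by rewrite -QV mulVmx.
pose N : 'M_(1 + n) := Q *m M *m Q^T.
have symN : N^T = N by rewrite /N !trmx_mul trmxK symM mulmxA.
have N0 : delta_mx 0 0 *m N = a *: delta_mx 0 0 :> 'rV_(1 + n).
  by rewrite /N !mulmxA eQ vM -scalemxAl -{1}eQ -mulmxA QQ mulmx1.
have N0j j : N 0 j = a * (j == 0)%:R.
  by move/rowP/(_ j): N0; rewrite -rowE !mxE.
have NQ : N = Q *m M *m Q^T by [].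
clearbody N.
have NE : N = block_mx a%:M 0 0 (drsubmx N).
  rewrite -{1}[N]submxK; congr block_mx.
  - by apply/matrixP => i j; rewrite !ord1 !mxE lshift0 N0j eqxx mulr1 mulr1n.
  - apply/matrixP => i j; rewrite !ord1 !mxE lshift0 N0j.
    by rewrite -val_eqE /= mulr0.
  - apply/matrixP => i j; rewrite !ord1 !mxE lshift0 -symN mxE N0j.
    by rewrite -val_eqE /= mulr0.
set N' := drsubmx N in NE.
have symN' : N'^T = N'.
  by apply/matrixP => i j; rewrite !mxE -[in LHS]symN mxE.
have chN' : char_poly N' = \prod_(x <- s) ('X - x%:P).
  apply: (mulfI (negbT (polyXsubC_eq0 a))).
  rewrite -chM -(char_poly_similar M Qu) QV -NQ NE.
  transitivity (char_poly (a%:M : 'M[R]_1) * char_poly N'); last first.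
    exact: esym (char_poly_block_diag _ _).
  congr (_ * _); rewrite /char_poly /char_poly_mx det_mx11 !mxE /= mulr1n.
  by rewrite mulr1n.
have [P' [PP' N'E]] := IH _ _ symN' chN'.
pose P1 : 'M_(1 + n) := block_mx 1%:M 0 0 P'.
have P1P1 : P1 *m P1^T = 1%:M.
  rewrite /P1 tr_block_mx mulmx_block !trmx0 trmx1 !mulmx0 !mul0mx !addr0 add0r.
  by rewrite mul1mx PP' -scalar_mx_block.
have dE : diag_mx (\row_i (a :: s)`_i) = block_mx a%:M 0 0 (diag_mx (\row_i s`_i)) :> 'M_(1 + n).
  have -> : \row_i (a :: s)`_i = row_mx a%:M (\row_(i < n) s`_i) :> 'rV_(1 + n).
    apply/rowP => i; rewrite !mxE; case: splitP => j ->; rewrite !mxE //.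
    by rewrite !ord1 /= mulr1n.
  by rewrite diag_mx_row; congr block_mx; apply/matrixP => i j; rewrite !ord1 !mxE.
exists (P1 *m Q); split.
  by rewrite trmx_mul !mulmxA -[P1 *m Q *m Q^T]mulmxA QQ mulmx1.
have P1N : N = P1^T *m diag_mx (\row_i (a :: s)`_i) *m P1.
  rewrite dE /P1 tr_block_mx !mulmx_block !trmx0 trmx1.
  rewrite !(mulmx0, mul0mx, addr0, add0r, mul1mx, mulmx1).
  by rewrite -N'E.
rewrite trmx_mul -!mulmxA ![P1^T *m _]mulmxA [_ *m (P1 *m Q)]mulmxA -P1N.
by rewrite NQ !mulmxA QtQ mul1mx -mulmxA QtQ mulmx1.
Qed.

(** * Variational bounds on eigenvalues *)

Definition quad (R : pzSemiRingType) (n : nat) (M : 'M[R]_n) (y : 'rV[R]_n) : R :=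
  (y *m M *m y^T) 0 0.

Definition sqnorm (R : pzSemiRingType) (n : nat) (y : 'rV[R]_n) : R :=
  \sum_j y 0 j ^+ 2.

Section Spectral.
Variables (R : rcfType) (n : nat) (M P : 'M[R]_n) (s : seq R).
Hypotheses (PP : P *m P^T = 1%:M) (MP : M = P^T *m diag_mx (\row_i s`_i) *m P).

Let PtP : P^T *m P = 1%:M.
Proof. exact: mulmx1C PP. Qed.

Lemma sqnorm_coords (z : 'rV[R]_n) : sqnorm (z *m P) = sqnorm z.
Proof.
have sqE (y : 'rV[R]_n) : sqnorm y = (y *m y^T) 0 0.
  by rewrite mulmx_row_tr mxE mulr1n; apply: eq_bigr => j _; rewrite expr2.
by rewrite !sqE trmx_mul !mulmxA -(mulmxA z) PP mulmx1.
Qed.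

Lemma quad_coords (z : 'rV[R]_n) : quad M (z *m P) = \sum_(j < n) s`_j * z 0 j ^+ 2.
Proof.
rewrite /quad MP trmx_mul !mulmxA -(mulmxA z) PP mulmx1 -(mulmxA _ P) PP mulmx1.
rewrite mulmx_row_tr mxE mulr1n; apply: eq_bigr => j _.
by rewrite mul_mx_diag !mxE; ring.
Qed.

Lemma coordsK (y : 'rV[R]_n) : y *m P^T *m P = y.
Proof. by rewrite -mulmxA PtP mulmx1. Qed.

Lemma quad_eigenvector (j : 'I_n) : exists2 y : 'rV[R]_n,
  0 < sqnorm y & quad M y = s`_j * sqnorm y.
Proof.
exists (delta_mx 0 j *m P).
  rewrite sqnorm_coords; apply: row_sqr_gt0.
  by apply/eqP => /rowP/(_ j)/eqP; rewrite !mxE !eqxx oner_eq0.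
rewrite quad_coords sqnorm_coords mulr_sumr; apply: eq_bigr => i _.
by rewrite mxE eqxx /=; case: eqVneq => [->//|_]; rewrite expr0n !mulr0.
Qed.

Hypothesis sorted_s : sorted <=%R s.
Hypothesis size_s : size s = n.

Let le_s (i j : nat) : (i <= j)%N -> (j < n)%N -> s`_i <= s`_j.
Proof.
move=> le_ij lt_jn; apply: (sorted_leq_nth le_trans lexx 0 sorted_s) => //.
  by rewrite inE size_s (leq_ltn_trans le_ij).
by rewrite inE size_s.
Qed.

(** The first two eigenvectors span a plane. It contains a nonzero vector orthogonal to [x], and on
    it the Rayleigh quotient is at most the second eigenvalue. *)
Lemma orthogonal_quad_le (x : 'rV[R]_n) : (1 < n)%N -> exists y : 'rV[R]_n,
  [/\ 0 < sqnorm y, y *m x^T = 0 & quad M y <= s`_1 * sqnorm y].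
Proof.
move=> n_gt1; pose i0 : 'I_n := Ordinal (ltnW n_gt1); pose i1 : 'I_n := Ordinal n_gt1.
have [c0 [c1 [c_neq0 c_orth]]] : exists c0 c1 : R, (c0 != 0) || (c1 != 0) /\
    c0 * (x *m P^T) 0 i0 + c1 * (x *m P^T) 0 i1 = 0.
  have [x00|x0_neq0] := eqVneq ((x *m P^T) 0 i0) 0.
    by exists 1, 0; rewrite oner_eq0 x00 mulr0 mul0r addr0.
  exists ((x *m P^T) 0 i1), (- (x *m P^T) 0 i0); rewrite oppr_eq0 x0_neq0 orbT.
  by split=> //; rewrite mulNr mulrC subrr.
pose z : 'rV[R]_n := c0 *: delta_mx 0 i0 + c1 *: delta_mx 0 i1.
have z0 : z 0 i0 = c0 by rewrite !mxE !eqxx /= mulr1 mulr0 addr0.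
have z1 : z 0 i1 = c1 by rewrite !mxE !eqxx /= mulr1 mulr0 add0r.
have zj j : j != i0 -> j != i1 -> z 0 j = 0.
  by move=> /negPf j0 /negPf j1; rewrite !mxE j0 j1 !mulr0 addr0.
exists (z *m P); split.
- rewrite sqnorm_coords; apply: row_sqr_gt0; apply: contraTneq c_neq0 => z_eq0.
  by rewrite -z0 -z1 z_eq0 !mxE eqxx.
- have -> : z *m P *m x^T = z *m (x *m P^T)^T by rewrite trmx_mul trmxK mulmxA.
  rewrite mulmx_row_tr (bigD1 i0) //= (bigD1 i1) //= big1 => [|j /andP[j0 j1]].
    by rewrite z0 z1 addr0 c_orth raddf0.
  by rewrite zj // mul0r.
rewrite quad_coords sqnorm_coords mulr_sumr; apply: ler_sum => j _.
have [->|j0] := eqVneq j i0; first by rewrite ler_wpM2r ?sqr_ge0 ?le_s.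
have [->//|j1] := eqVneq j i1.
by rewrite zj // expr0n !mulr0.
Qed.

(* Some combination of k vectors has vanishing first k - 1 eigencoordinates. *)
Lemma combination_quad_ge (k : nat) (x : 'I_k.+1 -> 'rV[R]_n) : (k < n)%N ->
  exists2 c : 'rV[R]_k.+1, c != 0 &
    let y := \sum_i c 0 i *: x i in s`_k * sqnorm y <= quad M y.
Proof.
move=> lt_kn; pose A : 'M[R]_(k.+1, k) :=
  \matrix_(i, j) (x i *m P^T) 0 (widen_ord (ltnW lt_kn) j).
have : kermx A != 0.
  rewrite kermx_eq0; apply/negP => /eqP rA.
  by have := rank_leq_col A; rewrite rA ltnn.
case/rowV0Pn => c /sub_kermxP cA c_neq0; exists c => //=.
set y := \sum_i _; rewrite -(coordsK y); set z := y *m P^T.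
have z0 (j : 'I_n) : (j < k)%N -> z 0 j = 0.
  move=> lt_jk; have /rowP/(_ (Ordinal lt_jk)) := cA.
  rewrite [RHS]mxE => cAj; rewrite /z /y mulmx_suml summxE -[RHS]cAj [RHS]mxE.
  have AE i : A i (Ordinal lt_jk) = (x i *m P^T) 0 j.
    by rewrite mxE; congr (_ 0 _); apply: val_inj.
  by apply: eq_bigr => i _; rewrite AE -scalemxAl [LHS]mxE.
rewrite quad_coords sqnorm_coords mulr_sumr; apply: ler_sum => j _.
have [lt_jk|le_kj] := ltnP j k; first by rewrite z0 // expr0n !mulr0.
by rewrite ler_wpM2r ?sqr_ge0 ?le_s.
Qed.

End Spectral.

(** * Energies, cuts and functions supported on half of the volume *)

Lemma sqr_max_split (R : realDomainType) (a : R) :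
  Num.max a 0 ^+ 2 + Num.max (- a) 0 ^+ 2 = a ^+ 2.
Proof.
case: (ltgtP a 0) => [a_lt0|a_gt0|->]; last by rewrite oppr0 maxxx expr0n addr0.
  by rewrite max_l ?oppr_ge0 1?ltW // expr0n add0r sqrrN.
by rewrite max_r ?oppr_le0 1?ltW // expr0n addr0.
Qed.

(** Equality holds for equal signs; for opposite signs the nonnegative term [- 2 * a * b] is
    dropped. *)
Lemma sqr_max_splitB (R : realDomainType) (a b : R) :
  (Num.max a 0 - Num.max b 0) ^+ 2 + (Num.max (- a) 0 - Num.max (- b) 0) ^+ 2
    <= (a - b) ^+ 2.
Proof.
case: (leP a 0) => a0; case: (leP b 0) => b0; case: (leP (- a) 0) => a0';
  case: (leP (- b) 0) => b0'; nra.
Qed.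

(** Ordered pairs count each edge twice, so this is twice the Dirichlet form, and a Rayleigh
    quotient [l] reads [energy = 2 * l * mass]. *)
Definition energy (R : realDomainType) (n : nat) (w : 'I_n -> 'I_n -> R) (g : 'I_n -> R) : R :=
  \sum_u \sum_v w u v * (g u - g v) ^+ 2.

Definition mass (R : realDomainType) (n : nat) (w : 'I_n -> 'I_n -> R) (g : 'I_n -> R) : R :=
  \sum_v wdeg w v * g v ^+ 2.

Section Graph.
Variables (R : rcfType) (n : nat) (w : 'I_n -> 'I_n -> R).
Hypothesis w_graph : is_wgraph w.
Hypothesis wdeg_ge1 : forall v, 1 <= wdeg w v.

Let w_sym i j : w i j = w j i. Proof. by case: w_graph. Qed.
Let w_ge0 i j : 0 <= w i j. Proof. by case: w_graph => _ []. Qed.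
Let wdeg_gt0 v : 0 < wdeg w v. Proof. exact: lt_le_trans (wdeg_ge1 v). Qed.

Lemma energy_ge0 (g : 'I_n -> R) : 0 <= energy w g.
Proof. by do 2![apply: sumr_ge0 => ? _]; rewrite mulr_ge0 ?sqr_ge0. Qed.

Lemma mass_ge0 (g : 'I_n -> R) : 0 <= mass w g.
Proof. by apply: sumr_ge0 => ? _; rewrite mulr_ge0 ?sqr_ge0 ?ltW. Qed.

Lemma sum_wdeg (a : 'I_n -> R) :
  \sum_u \sum_v w u v * a u = \sum_v wdeg w v * a v.
Proof. by apply: eq_bigr => u _; rewrite -mulr_suml. Qed.

Lemma sum_wdegr (a : 'I_n -> R) :
  \sum_u \sum_v w u v * a v = \sum_v wdeg w v * a v.
Proof.
rewrite exchange_big -sum_wdeg; apply: eq_bigr => u _; apply: eq_bigr => v _.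
by rewrite w_sym.
Qed.

Lemma energyE (g : 'I_n -> R) :
  energy w g = 2 * (mass w g - \sum_u \sum_v w u v * (g u * g v)).
Proof.
have -> : energy w g = \sum_u \sum_v w u v * g u ^+ 2 + \sum_u \sum_v w u v * g v ^+ 2
    - 2 * \sum_u \sum_v w u v * (g u * g v).
  rewrite mulr_sumr -big_split -sumrB; apply: eq_bigr => u _.
  rewrite mulr_sumr -big_split -sumrB; apply: eq_bigr => v _ /=; ring.
rewrite (sum_wdeg (fun u => g u ^+ 2)) (sum_wdegr (fun u => g u ^+ 2)) /mass; ring.
Qed.

Lemma energy_le_mass (g : 'I_n -> R) : energy w g <= 4 * mass w g.
Proof.
have -> : 4 * mass w g = \sum_u \sum_v w u v * (2 * g u ^+ 2) + \sum_u \sum_v w u v * (2 * g v ^+ 2).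
  rewrite (sum_wdeg (fun u => 2 * g u ^+ 2)) (sum_wdegr (fun u => 2 * g u ^+ 2)).
  rewrite /mass -big_split mulr_sumr; apply: eq_bigr => v _ /=; ring.
rewrite -big_split; apply: ler_sum => u _; rewrite -big_split; apply: ler_sum => v _ /=.
by rewrite -mulrDr ler_wpM2l //; have := sqr_ge0 (g u + g v); nra.
Qed.

Lemma nlaplacianE i j : nlaplacian w i j =
  (i == j)%:R - (Num.sqrt (wdeg w i))^-1 * w i j * (Num.sqrt (wdeg w j))^-1.
Proof.
by rewrite /nlaplacian /degmx_invsqrt mul_mx_diag mul_diag_mx !mxE.
Qed.

Lemma nlaplacian_sym : (nlaplacian w)^T = nlaplacian w.
Proof.
apply/matrixP => i j; rewrite mxE !nlaplacianE eq_sym w_sym; congr (_ - _); ring.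
Qed.

Let sqrt_wdeg_neq0 v : Num.sqrt (wdeg w v) != 0.
Proof. by rewrite gt_eqF // sqrtr_gt0. Qed.

Lemma sqnorm_mass (y : 'rV[R]_n) :
  sqnorm y = mass w (fun v => y 0 v / Num.sqrt (wdeg w v)).
Proof.
apply: eq_bigr => v _; rewrite expr_div_n sqr_sqrtr ?ltW //.
by rewrite mulrC divfK // gt_eqF.
Qed.

Lemma quad_nlaplacian (y : 'rV[R]_n) :
  2 * quad (nlaplacian w) y = energy w (fun v => y 0 v / Num.sqrt (wdeg w v)).
Proof.
rewrite energyE -sqnorm_mass; congr (_ * _).
rewrite /quad mulmx_row_tr mxE mulr1n /sqnorm -sumrB; apply: eq_bigr => u _.
rewrite mxE mulr_suml.
under eq_bigr do rewrite nlaplacianE mulrBr mulrBl.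
rewrite sumrB (bigD1 u) //= big1 => [|v /negPf vu]; last by rewrite vu mulr0 mul0r.
rewrite eqxx mulr1 addr0 expr2; congr (_ - _); apply: eq_bigr => v _.
rewrite w_sym; ring.
Qed.

Lemma volC (S : {set 'I_n}) : vol w (~: S) = vol w setT - vol w S.
Proof.
rewrite /vol [\sum_(v in setT) _](bigID (mem S)) /=.
under [X in _ = X + _ - _]eq_bigl do rewrite inE.
under [X in _ = _ + X - _]eq_bigl do rewrite inE -in_setC.
by rewrite addrAC subrr add0r.
Qed.

Lemma vol_subset (S T : {set 'I_n}) : S \subset T -> vol w S <= vol w T.
Proof.
move=> /subsetP ST; rewrite /vol [X in _ <= X]big_mkcond [X in X <= _]big_mkcond.
apply: ler_sum => v _; case: ifP => [/ST ->//|_].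
by case: ifP => // _; apply: ltW.
Qed.

(** Without division the empty set is allowed, and positive degrees exclude the whole vertex set, so
    the induction on supports meets no exception. *)
Lemma conductance_cut (S : {set 'I_n}) :
  2 * vol w S <= vol w setT -> graph_conductance w * vol w S <= cutw w S.
Proof.
move=> S_half; have [->|[v vS]] := set_0Vmem S.
  by rewrite /vol /cutw !big_set0 mulr0.
have volS_gt0 : 0 < vol w S.
  by apply: lt_le_trans (wdeg_gt0 v) _; rewrite /vol (bigD1 v) //= lerDl sumr_ge0 // => ? _; apply: ltW.
rewrite -ler_pdivlMr //; apply: (@bigmin_inf _ _ _ _ S).
  apply/andP; split; first by apply/set0Pn; exists v.
  by apply: contraTneq S_half => ST; rewrite -ltNge -ST; lra.
by rewrite /conductance (min_idPl _) // volC; lra.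
Qed.

Lemma sum_cut (S : {set 'I_n}) :
  \sum_u \sum_v w u v * ((u \in S) (+) (v \in S))%:R = 2 * cutw w S.
Proof.
have cutE : cutw w S = \sum_u \sum_v w u v * ((u \in S) && (v \notin S))%:R.
  rewrite /cutw big_mkcond; apply: eq_bigr => u _ /=.
  case: (u \in S) => /=; last by rewrite big1 // => v _; rewrite mulr0.
  rewrite big_mkcond; apply: eq_bigr => v _; rewrite inE.
  by case: (v \in S); rewrite ?mulr0 ?mulr1.
have cutE' : cutw w S = \sum_u \sum_v w u v * ((v \in S) && (u \notin S))%:R.
  by rewrite cutE exchange_big; do 2![apply: eq_bigr => ? _]; rewrite w_sym.
rewrite mulr_natl mulr2n {1}cutE cutE' -big_split; apply: eq_bigr => u _ /=.
rewrite -big_split; apply: eq_bigr => v _ /=; rewrite -mulrDr; congr (_ * _).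
by case: (u \in S); case: (v \in S); rewrite /= ?addr0 ?add0r.
Qed.

(* Induction on the support: subtracting the least positive value from h on its
   support S lowers the right-hand side by twice that value times the cut of S. *)
Lemma coarea (h : 'I_n -> R) :
  (forall v, 0 <= h v) -> 2 * vol w [set v | 0 < h v] <= vol w setT ->
  2 * (graph_conductance w * \sum_v wdeg w v * h v) <= \sum_u \sum_v w u v * `|h u - h v|.
Proof.
elim: {h}_.+1 {-2}h (ltnSn #|[set v | 0 < h v]|) => // m IH h; rewrite ltnS => le_m h_ge0 h_half.
set S := [set v | 0 < h v] in le_m h_half.
have hS v : v \notin S -> h v = 0.
  by rewrite inE lt_def h_ge0 andbT negbK => /eqP.
have [S0|[v0 v0S]] := set_0Vmem S.
  rewrite big1 => [|v _]; last by rewrite hS ?S0 ?inE // mulr0.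
  by rewrite !mulr0; do 2![apply: sumr_ge0 => ? _]; rewrite mulr_ge0.
case: (arg_minP h v0S) => v; rewrite /= => vS v_min.
pose h' u := h u - h v * (u \in S)%:R.
have h'_ge0 u : 0 <= h' u.
  rewrite /h'; case: (boolP (u \in S)) => [/v_min|/hS ->].
    by rewrite mulr1 subr_ge0.
  by rewrite mulr0 subr0.
have sub : [set u | 0 < h' u] \proper S.
  apply/properP; split; last by exists v => //; rewrite inE /h' (vS : v \in S) mulr1 subrr ltxx.
  apply/subsetP => u; rewrite inE /h'; case: (boolP (u \in S)) => // uS.
  by rewrite mulr0 subr0 hS // ltxx.
have volS' := vol_subset (proper_sub sub).
have {}IH := IH h' (leq_trans (proper_card sub) le_m) h'_ge0 _.
have {}IH : 2 * (graph_conductance w * \sum_(u < n) wdeg w u * h' u)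
    <= \sum_(u < n) \sum_(u0 < n) w u u0 * `|h' u - h' u0| by apply: IH; lra.
have sumE : \sum_(u < n) wdeg w u * h u = \sum_(u < n) wdeg w u * h' u + h v * vol w S.
  rewrite /vol [X in h v * X]big_mkcond mulr_sumr -big_split; apply: eq_bigr => u _ /=.
  by rewrite /h'; case: (u \in S); rewrite ?mulr1n ?mulr0n; ring.
have difE : \sum_(u < n) \sum_(u0 < n) w u u0 * `|h u - h u0| =
    \sum_(u < n) \sum_(u0 < n) w u u0 * `|h' u - h' u0| + h v * (2 * cutw w S).
  rewrite -sum_cut mulr_sumr -big_split; apply: eq_bigr => u _ /=.
  rewrite mulr_sumr -big_split; apply: eq_bigr => u0 _ /=.
  rewrite mulrCA -mulrDr; congr (_ * _); rewrite /h'.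
  (* Only edges leaving [S] change: by minimality of [h v] the difference keeps its sign and drops
     by exactly [h v]. *)
  case: (boolP (u \in S)) => [uS|/hS->]; case: (boolP (u0 \in S)) => [u0S|/hS->] /=.
  - by rewrite mulr0 addr0; congr `|_|; ring.
  - have := v_min _ uS; rewrite !mulr1 mulr0 !subr0 => le_v.
    by rewrite !ger0_norm ?subr_ge0 ?h_ge0 //; ring.
  - have := v_min _ u0S; rewrite !mulr1 mulr0 !subr0 !sub0r !normrN => le_v.
    by rewrite !ger0_norm ?subr_ge0 ?h_ge0 //; ring.
  - by rewrite !mulr0 addr0 !subr0.
rewrite sumE difE mulrDr mulrDr; apply: lerD => //.
rewrite [graph_conductance w * _]mulrCA [2 * (_ * _)]mulrCA; apply: ler_wpM2l => //.
by rewrite ler_pM2l // conductance_cut.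
Qed.

(** Take the least value [g v] with at most half of the volume strictly above it. If more than half
    lay strictly below, the largest value below [g v] would qualify too. *)
Lemma weighted_median (g : 'I_n -> R) : (0 < n)%N -> exists c : R,
  2 * vol w [set v | c < g v] <= vol w setT /\ 2 * vol w [set v | g v < c] <= vol w setT.
Proof.
move=> n_gt0; have vol_ge0 S : 0 <= vol w S by apply: sumr_ge0 => v _; apply: ltW.
pose P v := 2 * vol w [set u | g v < g u] <= vol w setT.
pose i0 := Ordinal n_gt0.
case: (@arg_maxP _ _ _ i0 predT g isT) => v1 _ v1_max.
have Pv1 : P v1.
  rewrite /P; have -> : [set u | g v1 < g u] = set0.
    by apply/setP => u; rewrite !inE ltNge; apply/negbF/v1_max.
  by rewrite {1}/vol big_set0 mulr0.
case: (arg_minP g Pv1) => v Pv v_min; exists (g v); split=> //.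
rewrite leNgt; apply/negP => big_lt.
have [S0|[u0]] := set_0Vmem [set u | g u < g v].
  by move: big_lt; rewrite S0 [X in _ < 2 * X]big_set0 mulr0 ltNge vol_ge0.
rewrite inE => u0v.
case: (@arg_maxP _ _ _ u0 (fun x => g x < g v) g u0v) => u /= uv u_max.
have : P u.
  rewrite /P; have -> : [set x | g u < g x] = ~: [set x | g x < g v].
    apply/setP => x; rewrite !inE -leNgt; apply/idP/idP => [ux|/(lt_le_trans uv)//].
    by rewrite leNgt; apply: contraTN ux => /u_max; rewrite ltNge negbK.
  by rewrite volC; lra.
by move/v_min; rewrite leNgt uv.
Qed.

(** The positive and negative parts of [g - c], for a median [c], have total energy at most that of
    [g]. Their total mass is at least that of [g], since subtracting a constant cannot lower the
    mass of a function orthogonal to constants. Hence one of the parts works. *)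
Lemma half_support_function (g : 'I_n -> R) (l : R) : (0 < n)%N ->
  0 < mass w g -> \sum_v wdeg w v * g v = 0 -> energy w g <= 2 * l * mass w g ->
  exists f : 'I_n -> R, [/\ forall v, 0 <= f v, 2 * vol w [set v | 0 < f v] <= vol w setT,
    0 < mass w f & energy w f <= 2 * l * mass w f].
Proof.
move=> n_gt0 g_gt0 g_orth g_le; have [c [c_gt c_lt]] := weighted_median g n_gt0.
pose f1 v := Num.max (g v - c) 0; pose f2 v := Num.max (- (g v - c)) 0.
have f1_supp : 2 * vol w [set v | 0 < f1 v] <= vol w setT.
  by under eq_finset do rewrite lt_max ltxx orbF subr_gt0.
have f2_supp : 2 * vol w [set v | 0 < f2 v] <= vol w setT.
  by under eq_finset do rewrite lt_max ltxx orbF opprB subr_gt0.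
have energy_le : energy w f1 + energy w f2 <= energy w g.
  rewrite /energy -big_split; apply: ler_sum => u _; rewrite -big_split; apply: ler_sum => v _ /=.
  rewrite -mulrDr ler_wpM2l //; apply: le_trans (sqr_max_splitB _ _) _.
  by have -> : g u - c - (g v - c) = g u - g v by ring.
have mass_le : mass w g <= mass w f1 + mass w f2.
  have -> : mass w f1 + mass w f2 = mass w g + c ^+ 2 * \sum_v wdeg w v
      - 2 * c * \sum_v wdeg w v * g v.
    rewrite /mass !mulr_sumr -!big_split -sumrB; apply: eq_bigr => v _ /=; rewrite /f1 /f2.
    by rewrite -mulrDr sqr_max_split; ring.
  by rewrite g_orth mulr0 subr0 lerDl mulr_ge0 ?sqr_ge0 // sumr_ge0 // => v _; apply: ltW.
have f1_ge0 v : 0 <= f1 v by rewrite le_max lexx orbT.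
have f2_ge0 v : 0 <= f2 v by rewrite le_max lexx orbT.
have l_ge0 : 0 <= l.
  have := le_trans (energy_ge0 g) g_le; rewrite pmulr_lge0 //; lra.
have [E1|E1] := boolP ((0 < mass w f1) && (energy w f1 <= 2 * l * mass w f1)).
  by case/andP: E1 => *; exists f1.
have [E2|E2] := boolP ((0 < mass w f2) && (energy w f2 <= 2 * l * mass w f2)).
  by case/andP: E2 => *; exists f2.
exfalso; move: E1 E2; rewrite !negb_and -!ltNge -!leNgt.
have := mass_ge0 f1; have := mass_ge0 f2.
have := energy_ge0 f1; have := energy_ge0 f2.
by move=> ? ? ? ? /orP[?|?] /orP[?|?]; nra.
Qed.

End Graph.

(** * Tents, their primitives and greedy thresholds *)

Section Tents.
Variable R : realFieldType.
Implicit Types (a b x y : R) (h mu : R -> R).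

(** For [a <= b], the distance from [x] to the complement of the open interval from [a] to [b]. *)
Definition tent a b x : R := Num.max 0 (Num.min (x - a) (b - x)).

(* The antiderivative of the tent function, valid on [a, b]. *)
Definition tent_prim a b x : R :=
  if x <= (a + b) / 2 then (x - a) ^+ 2 / 2 else (b - a) ^+ 2 / 4 - (b - x) ^+ 2 / 2.

(* On [a, c], h plays the role of the primitive of the distance mu to a set of at most
   m + 1 thresholds including a; the last condition is the lower bound on h that
   Cauchy-Schwarz gives for m gaps. *)
Definition profile a c (m : nat) h mu : Prop :=
  [/\ h a = 0, mu a = 0, forall x, a <= x -> x <= c -> 0 <= mu x,
      forall x y, a <= x -> x <= y -> y <= c ->
        0 <= h y - h x /\ h y - h x <= (y - x) * (mu x + (y - x))
    & forall x, a <= x -> x <= c -> (x - a) ^+ 2 <= 4 * m%:R * h x].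

(** The first clause leaves room for another tent to the left of [a]. The last bounds the total
    increment, which is stronger than each tent being 1-Lipschitz and lets the tents share the
    energy of one function. *)
Definition disjoint_tents a (m : nat) (g : nat -> R -> R) : Prop :=
  [/\ forall i x, x <= a -> g i x = 0,
      forall i j x, (i < m)%N -> (j < m)%N -> i != j -> g i x * g j x = 0
    & forall x y, \sum_(i < m) `|g i x - g i y| <= `|x - y|].

Lemma tent_ge0 a b x : 0 <= tent a b x.
Proof. by rewrite le_max lexx. Qed.

Lemma tent_out a b x : (x <= a) || (b <= x) -> tent a b x = 0.
Proof. by move=> H; apply: max_l; rewrite ge_min !subr_le0. Qed.

Lemma tent_left a b x : a <= x -> x <= (a + b) / 2 -> tent a b x = x - a.
Proof. by move=> ? ?; rewrite /tent min_l ?max_r; lra. Qed.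

Lemma tent_right a b x : x <= b -> (a + b) / 2 <= x -> tent a b x = b - x.
Proof. by move=> ? ?; rewrite /tent min_r ?max_r; lra. Qed.

Lemma profile_tent a b : a <= b -> profile a b 1 (tent_prim a b) (tent a b).
Proof.
move=> ab; split.
- by rewrite /tent_prim; case: (leP a) => ?; [rewrite subrr expr0n mul0r | lra].
- by rewrite tent_out ?lexx.
- by move=> *; apply: tent_ge0.
- move=> x y ax xy yb; rewrite /tent_prim.
  case: (leP x) => x_mid; case: (leP y) => y_mid.
  + by rewrite tent_left //; split; nra.
  (* Half the length of the interval, and the distances of [x] and [y] from its midpoint. *)
  + rewrite tent_left //; set d := (b - a) / 2; set p := (a + b) / 2 - x; set r := y - (a + b) / 2.
    have -> : (b - a) ^+ 2 / 4 - (b - y) ^+ 2 / 2 - (x - a) ^+ 2 / 2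
      = d * (p + r) - (r ^+ 2 + p ^+ 2) / 2 by rewrite /d /p /r; field.
    have -> : (y - x) * (x - a + (y - x)) = (p + r) * (d + r) by rewrite /d /p /r; field.
    have [p0 r0 pd rd] : [/\ 0 <= p, 0 <= r, p <= d & r <= d] by rewrite /d /p /r; split; lra.
    by split; nra.
  + lra.
  + have -> : tent a b x = b - x by apply: tent_right; lra.
    by split; nra.
- move=> x ax xb; rewrite /tent_prim; case: (leP x ((a + b) / 2)) => x_mid; first by nra.
  (* On the right half this product is [4 * tent_prim a b x - (x - a) ^+ 2]. *)
  have : 0 <= (b - x) * (2 * (x - a) - (b - x)) by apply: mulr_ge0; lra.
  by move=> ?; nra.
Qed.

Lemma tent_lipschitz a b x y : `|tent a b x - tent a b y| <= `|x - y|.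
Proof.
wlog xy : x y / x <= y.
  by move=> H; case: (leP x y) => [/H//|/ltW/H]; rewrite distrC [`|y - x|]distrC.
rewrite [`|x - y|]distrC [`|y - x|]ger0_norm ?subr_ge0 // ler_norml /tent.
case: (leP (x - a) (b - x)) => ?; case: (leP (y - a) (b - y)) => ?;
  case: (leP 0 (_ : R)) => ?; case: (leP 0 (_ : R)) => ?; apply/andP; split; lra.
Qed.

Lemma profile_leq a c m m' h mu : (m <= m')%N -> profile a c m h mu -> profile a c m' h mu.
Proof.
move=> mm' [ha mua mu0 hP hlow]; split=> // x ax xc; apply: le_trans (hlow x ax xc) _.
have [h_ge0 _] := hP a x (lexx a) ax xc.
by rewrite ler_wpM2r ?ler_wpM2l ?ler_nat //; lra.
Qed.

(** The primitives are concatenated. An increment across [b] is split at [b], where [mu2] vanishes,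
    and Cauchy-Schwarz carries the quadratic lower bound from 1 and [m] gaps to [m.+1]. *)
Lemma profile_glue a b c m h1 mu1 h2 mu2 : a <= b -> b <= c ->
  profile a b 1 h1 mu1 -> profile b c m h2 mu2 ->
  profile a c m.+1 (fun x => if x <= b then h1 x else h1 b + h2 x)
                   (fun x => if x <= b then mu1 x else mu2 x).
Proof.
move=> ab bc [h1a mu1a mu1_ge0 h1P h1low] [h2b mu2b mu2_ge0 h2P h2low]; split.
- by rewrite ab.
- by rewrite ab.
- by move=> x ax xc; case: (leP x b) => xb; [apply: mu1_ge0 | apply: mu2_ge0 => //; apply: ltW].
- move=> x y ax xy yc; case: (leP x b) => xb; case: (leP y b) => yb.
  + exact: h1P.
  + have [] := h1P x b ax xb (lexx b); have [] := h2P b y (lexx b) (ltW yb) yc.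
    have := mu1_ge0 x ax xb; rewrite h2b mu2b => *; split; nra.
  + lra.
  + have [? ?] := h2P x y (ltW xb) xy yc.
    by have -> : h1 b + h2 y - (h1 b + h2 x) = h2 y - h2 x by ring.
- move=> x ax xc; rewrite -[m.+1]addn1 natrD; case: (leP x b) => xb.
    have := h1low x ax xb; have [] := h1P a x (lexx a) ax xb; rewrite h1a subr0 => h1_ge0 _.
    have := mulr_ge0 (ler0n R m) h1_ge0; nra.
  have := h1low b ab (lexx b); have := h2low x (ltW xb) xc.
  have [] := h1P a b (lexx a) ab (lexx b); rewrite h1a subr0 => h1_ge0 _.
  (* For [m = 0] the bound on [h2] reads [(x - b) ^+ 2 <= 0], against [b < x]. *)
  case: m h2low => [|m] _; first by rewrite mulr0 mul0r add0r; nra.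
  set N : R := m.+1%:R; have N_gt0 : 0 < N by rewrite ltr0n.
  move=> h2x h1b; rewrite -(ler_pM2l N_gt0).
  (* Cauchy-Schwarz with weights 1 and [N], denominators cleared and the defect written as a
     square. *)
  have -> : N * (x - a) ^+ 2 = (N + 1) * (N * (b - a) ^+ 2 + (x - b) ^+ 2) - (N * (b - a) - (x - b)) ^+ 2.
    by ring.
  have ? := sqr_ge0 (N * (b - a) - (x - b)).
  apply: (@le_trans _ _ ((N + 1) * (N * (4 * h1 b) + 4 * N * h2 x))); last by lra.
  have lower : N * (b - a) ^+ 2 + (x - b) ^+ 2 <= N * (4 * h1 b) + 4 * N * h2 x.
    by apply: lerD => //; rewrite ler_pM2l //; lra.
  rewrite lerBlDr -[X in X <= _]addr0; apply: lerD => //.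
  by rewrite ler_pM2l // addr_gt0.
Qed.

Lemma disjoint_tents_cons a b m g : a <= b -> disjoint_tents b m g ->
  disjoint_tents a m.+1 (fun i => if i is i'.+1 then g i' else tent a b).
Proof.
move=> ab [g_out g_disj g_lip]; split.
- by case=> [|i] x xa; [rewrite tent_out ?xa | rewrite g_out // (le_trans xa)].
- have tg i x : tent a b x * g i x = 0.
    by case: (leP x b) => xb; [rewrite g_out ?mulr0 | rewrite tent_out ?mul0r // (ltW xb) orbT].
  by case=> [|i] [|j] x // i_lt j_lt ij; [rewrite mulrC | apply: g_disj].
move=> x y; rewrite big_ord_recl /=.
have gmax i z : g i z = g i (Num.max z b).
  by case: (leP z b) => // zb; rewrite !g_out.
under eq_bigr do rewrite add0n (gmax _ x) (gmax _ y).
(* The move from [x] to [y] is cut at [b]: the new tent sees only the part below, the old ones only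
   the part above, and the two lengths add up. *)
apply: (@le_trans _ _ (`|Num.min x b - Num.min y b| + `|Num.max x b - Num.max y b|)).
  apply: lerD => //.
  have tmin z : tent a b z = tent a b (Num.min z b).
    by case: (leP z b) => // zb; rewrite (@tent_out a b z) ?(ltW zb) ?orbT // tent_out ?lexx ?orbT.
  rewrite (tmin x) (tmin y).
  exact: tent_lipschitz.
by case: (leP x b) => ?; case: (leP y b) => ?; rewrite ?subrr ?normr0 ?addr0 ?add0r //;
  [rewrite !ler0_norm | rewrite !ger0_norm]; lra.
Qed.

End Tents.

(** Induction on [m], scanning to the right from [a] for the least value [f v] whose tent from [a]
    has mass at least [C]. If there is none, a single tent up to [c] is the profile. Otherwise this
    tent joins the family, or the profile gets two new gaps, ending at [b'] and at [f v]; hence the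
    count [m.*2]. *)
Lemma tents_or_profile (R : realFieldType) (n : nat) (wt f : 'I_n -> R) (C c : R) (m : nat) (a : R) :
  (forall v, 0 <= wt v) -> 0 < C -> (exists v, f v = c) -> (forall v, f v <= c) -> a <= c ->
  (exists2 g, disjoint_tents a m g &
     forall i, (i < m)%N -> C <= \sum_v wt v * g i (f v) ^+ 2) \/
  (exists h mu, profile a c m.*2 h mu /\
     \sum_(v | a < f v) wt v * mu (f v) ^+ 2 <= m%:R * C).
Proof.
move=> wt_ge0 C_gt0 [vc f_vc] f_le; elim: m a => [|m IH] a ac.
  left; exists (fun _ _ => 0) => //; split=> // *.
  by rewrite big_ord0.
have wt_sqr_ge0 v (x : R) : 0 <= wt v * x ^+ 2 by rewrite mulr_ge0 ?sqr_ge0.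
pose e b := \sum_v wt v * tent a b (f v) ^+ 2.
have e_err b (A : pred 'I_n) : \sum_(v | A v) wt v * tent a b (f v) ^+ 2 <= e b.
  by rewrite big_mkcond; apply: ler_sum => v _; case: ifP => // _; apply: wt_sqr_ge0.
have e_a : e a = 0.
  by rewrite /e big1 // => v _; rewrite tent_out ?expr0n ?mulr0 // le_total.
case: (pickP (fun v => (a < f v) && (C <= e (f v)))) => [v0 v0P|none]; last first.
  right; exists (tent_prim a c), (tent a c); split.
    exact: profile_leq (profile_tent ac).
  apply: le_trans (e_err _ _) _; apply: (@le_trans _ _ C); last first.
    by rewrite ler_peMl ?ler1n // ltW.
  (* As [c] is a value of [f], either [e c < C], or [a = c] and the error is [e a = 0]. *)
  have := none vc; rewrite f_vc; case: (leP C (e c)) => [|/ltW//].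
  rewrite andbT; case: (ltgtP a c) ac => // <- _ _ _.
  by rewrite e_a ltW.
case: (@arg_minP _ _ _ v0 (fun v => (a < f v) && (C <= e (f v))) f v0P) => v /= /andP[av Cv] v_min.
(* The mass may jump past [C] between consecutive values of [f]. So [b'] is the value preceding
   [f v], or [a] if there is none above [a]: its error is still at most [C], and no value lies
   strictly between [b'] and [f v]. *)
have [b' [ab' b'v gap eb']] : exists b', [/\ a <= b', b' < f v,
    forall u, a < f u -> f u < f v -> f u <= b' & e b' <= C].
  case: (pickP (fun u => (a < f u) && (f u < f v))) => [u0 u0P|no_u].
    case: (@arg_maxP _ _ _ u0 (fun u => (a < f u) && (f u < f v)) f u0P) => u /= /andP[au uv] u_max.
    exists (f u); split=> //; first exact: ltW.
      by move=> x ax xv; apply: u_max; rewrite ax.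
    rewrite leNgt; apply/negP => /ltW Cu.
    by have := v_min u; rewrite au Cu leNgt uv => /(_ isT).
  exists a; split=> //; last by rewrite e_a ltW.
  by move=> u au uv; have := no_u u; rewrite au uv.
case: (IH (f v) (f_le v)) => [[g g_tents g_mass]|[h [mu [hmu_prof hmu_err]]]]; [left|right].
  exists (fun i => if i is i'.+1 then g i' else tent a (f v)).
    exact: disjoint_tents_cons (ltW av) g_tents.
  by case=> [|i] // lt_im; apply: g_mass.
have glue := profile_glue (ltW b'v) (f_le v) (profile_tent (ltW b'v)) hmu_prof.
have {}glue := profile_glue ab' (le_trans (ltW b'v) (f_le v)) (profile_tent ab') glue.
eexists; eexists; split; first exact: glue.
have [_ mu_v _ _ _] := hmu_prof.
rewrite -[m.+1]addn1 natrD mulrDl mul1r addrC.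
(* Values up to [b'] are charged to [eb'] and those beyond [f v] to [hmu_err]; at [f v] itself the
   distance is 0. *)
apply: le_trans (lerD eb' hmu_err); rewrite big_mkcond [X in _ <= _ + X]big_mkcond /e -big_split.
apply: ler_sum => u _ /=; case: (ltP a (f u)) => au; last first.
  by rewrite ltNge (le_trans au (ltW av)) addr0.
case: (leP (f u) b') => ub'.
  by rewrite ltNge (le_trans ub' (ltW b'v)) addr0.
have vu : f v <= f u.
  by rewrite leNgt; apply/negP => uv; have := gap u au uv; rewrite leNgt ub'.
case: (ltgtP (f v) (f u)) vu => // [vu|<-] _.
  by rewrite lerDr.
by rewrite addr0 [tent b' _ _]tent_out ?lexx ?orbT // expr0n mulr0.
Qed.

(** * Sums of functions with disjoint supports *)

Lemma sqr_sum_orthogonal (R : realDomainType) (I : finType) (P : pred I) (a : I -> R) :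
  (forall i j, i != j -> a i * a j = 0) ->
  (\sum_(i | P i) a i) ^+ 2 = \sum_(i | P i) a i ^+ 2.
Proof.
move=> a_orth; rewrite expr2 mulr_suml; apply: eq_bigr => i Pi.
rewrite (bigD1 i) //= mulrDr mulr_sumr big1 ?addr0 ?expr2 // => j /andP[_ ji].
by rewrite a_orth // eq_sym.
Qed.

(* At most one a i and one b i are nonzero, so the sum has at most two terms. *)
Lemma sqr_sum_disjoint_le (R : realDomainType) (I : finType) (a b : I -> R) :
  (forall i j, i != j -> a i * a j = 0) -> (forall i j, i != j -> b i * b j = 0) ->
  (\sum_i a i - \sum_i b i) ^+ 2 <= 2 * \sum_i (a i - b i) ^+ 2.
Proof.
move=> a_orth b_orth; case: (pickP (fun i => a i != 0)) => [i0 a_i0|a0]; last first.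
  have a_eq0 i : a i = 0 by have /negbFE/eqP := a0 i.
  rewrite [X in X - _]big1 // sub0r sqrrN (sqr_sum_orthogonal _ b_orth) mulr_sumr.
  by apply: ler_sum => i _; rewrite a_eq0 sub0r sqrrN ler_peMl ?sqr_ge0 // ler1n.
have a_eq0 i : i != i0 -> a i = 0.
  by move/a_orth/eqP; rewrite mulf_eq0 (negPf a_i0) orbF => /eqP.
rewrite -sumrB (bigD1 i0) //= [in X in _ <= X](bigD1 i0) //=.
have -> : \sum_(i | i != i0) (a i - b i) = - \sum_(i | i != i0) b i.
  by rewrite -sumrN; apply: eq_bigr => i /a_eq0 ->; rewrite sub0r.
have -> : \sum_(i | i != i0) (a i - b i) ^+ 2 = (\sum_(i | i != i0) b i) ^+ 2.
  rewrite (sqr_sum_orthogonal _ b_orth); apply: eq_bigr => i /a_eq0 ->.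
  by rewrite sub0r sqrrN.
move: (a i0 - b i0) (\sum_(i | _) _) => x y.
by have := sqr_ge0 (x + y); nra.
Qed.

Lemma size_spectrum (R : rcfType) (n : nat) (M : 'M[R]_n) (s : seq R) :
  sorted_spectrum M s -> size s = n.
Proof.
by case=> _ chM; have := size_char_poly M; rewrite chM (size_prod_XsubC s id) => -[].
Qed.

(** * Spectral consequences and the conductance bound *)

Section ImprovedCheeger.
Variables (R : rcfType) (n : nat) (w : 'I_n -> 'I_n -> R) (s : seq R).
Hypothesis w_graph : is_wgraph w.
Hypothesis wdeg_ge1 : forall v, 1 <= wdeg w v.
Hypothesis spec : sorted_spectrum (nlaplacian w) s.

Let w_ge0 i j : 0 <= w i j. Proof. by case: w_graph => _ []. Qed.
Let wdeg_gt0 v : 0 < wdeg w v. Proof. exact: lt_le_trans (wdeg_ge1 v). Qed.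
Let sqrt_wdeg_neq0 v : Num.sqrt (wdeg w v) != 0.
Proof. by rewrite gt_eqF // sqrtr_gt0. Qed.

(** Later this bounds the square root of an eigenvalue by 2, which absorbs a lower-order term. *)
Lemma eigenvalue_le2 (k : nat) : (k < n)%N -> s`_k <= 2.
Proof.
move=> lt_kn; have [P [PP MP]] := symmetric_spectral (nlaplacian_sym w_graph) (proj2 spec).
have [y y_gt0 y_eq] := quad_eigenvector PP MP (Ordinal lt_kn).
have := energy_le_mass w_graph (fun v => y 0 v / Num.sqrt (wdeg w v)).
rewrite -(quad_nlaplacian w_graph wdeg_ge1) -(sqnorm_mass wdeg_ge1) y_eq /= mulrA.
by rewrite ler_pM2r //; lra.
Qed.

(** Min-max on the span of the [g i]. Edges between two supports cost a factor 2, and [rho] bounds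
    twice the Rayleigh quotients because [energy] counts edges twice, so the conclusion is [rho]
    itself. *)
Lemma disjoint_functions_eigenvalue (k : nat) (g : 'I_k.+1 -> 'I_n -> R) (rho : R) :
  (k < n)%N -> (forall i j v, i != j -> g i v * g j v = 0) ->
  (forall i, 0 < mass w (g i)) -> (forall i, energy w (g i) <= rho * mass w (g i)) ->
  s`_k <= rho.
Proof.
move=> lt_kn g_disj g_gt0 g_le.
have [P [PP MP]] := symmetric_spectral (nlaplacian_sym w_graph) (proj2 spec).
pose x i : 'rV[R]_n := \row_v (Num.sqrt (wdeg w v) * g i v).
have [c c_neq0] := combination_quad_ge PP MP (proj1 spec) (size_spectrum spec) x lt_kn.
set y := \sum_i _ => /= y_le.
pose G v := \sum_i c 0 i * g i v.
have yG v : y 0 v / Num.sqrt (wdeg w v) = G v.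
  rewrite summxE mulr_suml; apply: eq_bigr => i _; rewrite !mxE -mulrA; congr (_ * _).
  by rewrite mulrC mulKf.
have massG : mass w G = \sum_i c 0 i ^+ 2 * mass w (g i).
  under eq_bigr do rewrite mulr_sumr.
  rewrite exchange_big; apply: eq_bigr => v _ /=.
  rewrite sqr_sum_orthogonal => [|i j ij]; last by rewrite mulrACA g_disj ?mulr0.
  by rewrite mulr_sumr; apply: eq_bigr => i _; rewrite exprMn mulrCA.
have energyG : energy w G <= 2 * \sum_i c 0 i ^+ 2 * energy w (g i).
  have -> : \sum_i c 0 i ^+ 2 * energy w (g i) =
      \sum_u \sum_v w u v * \sum_i (c 0 i * g i u - c 0 i * g i v) ^+ 2.
    under eq_bigr do rewrite mulr_sumr; rewrite exchange_big; apply: eq_bigr => u _ /=.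
    under eq_bigr do rewrite mulr_sumr; rewrite exchange_big; apply: eq_bigr => v _ /=.
    by rewrite mulr_sumr; apply: eq_bigr => i _; rewrite -mulrBr exprMn mulrCA.
  rewrite mulr_sumr; apply: ler_sum => u _; rewrite mulr_sumr; apply: ler_sum => v _.
  rewrite [X in _ <= X]mulrCA; apply: ler_wpM2l => //.
  by apply: sqr_sum_disjoint_le => i j ij; rewrite mulrACA g_disj ?mulr0.
have massG_gt0 : 0 < mass w G.
  have [i ci] : exists i, c 0 i != 0 by apply/rV0Pn.
  rewrite massG (bigD1 i) //=; apply: ltr_wpDr.
    by apply: sumr_ge0 => j _; rewrite mulr_ge0 ?sqr_ge0 ?ltW.
  by rewrite mulr_gt0 // exprn_even_gt0.
have y_mass : sqnorm y = mass w G.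
  by rewrite (sqnorm_mass wdeg_ge1); apply: eq_bigr => v _; rewrite yG.
have y_energy : 2 * quad (nlaplacian w) y = energy w G.
  rewrite (quad_nlaplacian w_graph wdeg_ge1).
  by apply: eq_bigr => u _; apply: eq_bigr => v _; rewrite !yG.
rewrite -(ler_pM2r massG_gt0) -(@ler_pM2l _ 2) //.
apply: (@le_trans _ _ (energy w G)); first by rewrite -y_energy -y_mass ler_pM2l.
apply: le_trans energyG _; rewrite ler_pM2l // massG mulr_sumr.
by apply: ler_sum => i _; rewrite mulrCA ler_wpM2l ?sqr_ge0.
Qed.

(** Dividing a vector orthogonal to the square roots of the degrees by these roots gives a function
    of degree-weighted mean zero, which can be cut at its median. *)
Lemma test_function : (1 < n)%N -> exists f : 'I_n -> R,
  [/\ forall v, 0 <= f v, 2 * vol w [set v | 0 < f v] <= vol w setT,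
    0 < mass w f & energy w f <= 2 * s`_1 * mass w f].
Proof.
move=> n_gt1; have [P [PP MP]] := symmetric_spectral (nlaplacian_sym w_graph) (proj2 spec).
have [y [y_gt0 y_orth y_le]] := orthogonal_quad_le PP MP (proj1 spec) (size_spectrum spec)
  (\row_v Num.sqrt (wdeg w v)) n_gt1.
apply: (half_support_function w_graph wdeg_ge1 (g := fun v => y 0 v / Num.sqrt (wdeg w v))).
- exact: ltnW.
- by rewrite -(sqnorm_mass wdeg_ge1).
- move: y_orth; rewrite mulmx_row_tr => /matrixP/(_ 0 0); rewrite !mxE mulr1n => y_orth.
  rewrite -[RHS]y_orth; apply: eq_bigr => v _; rewrite mxE.
  by rewrite -{1}[wdeg w v]sqr_sqrtr ?ltW // mulrCA expr2 mulfK.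
- rewrite -(quad_nlaplacian w_graph wdeg_ge1) -(sqnorm_mass wdeg_ge1) -mulrA.
  by rewrite ler_pM2l.
Qed.

(* 2 k tents share the energy of f, so k of them have at most a k-th of it each. *)
Lemma tents_eigenvalue (f : 'I_n -> R) (k : nat) (a C : R) (g : nat -> R -> R) :
  (k < n)%N -> 0 < C -> 0 < energy w f -> disjoint_tents a k.+1.*2 g ->
  (forall i, (i < k.+1.*2)%N -> C <= mass w (fun v => g i (f v))) ->
  s`_k <= energy w f / (k.+1%:R * C).
Proof.
move=> lt_kn C_gt0 E_gt0 [_ g_disj g_lip] g_mass.
pose E i := energy w (fun v => g i (f v)).
have sumE : \sum_(i < k.+1.*2) E i <= energy w f.
  rewrite exchange_big; apply: ler_sum => u _; rewrite exchange_big; apply: ler_sum => v _ /=.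
  rewrite -mulr_sumr ler_wpM2l //; set d := f u - f v.
  (* One factor of each square is bounded by [|d|], and the other factors sum to at most [|d|]. *)
  apply: (@le_trans _ _ (\sum_(i < k.+1.*2) `|d| * `|g i (f u) - g i (f v)|)).
    apply: ler_sum => i _; rewrite -real_normK ?num_real // expr2 ler_wpM2r //.
    by apply: le_trans (g_lip _ _); rewrite (bigD1 i) //= lerDl sumr_ge0.
  by rewrite -mulr_sumr -[X in _ <= X]real_normK ?num_real // expr2 ler_wpM2l.
pose J := [set i : 'I_k.+1.*2 | E i <= energy w f / k.+1%:R].
have card_J : (k.+1 <= #|J|)%N.
  rewrite leqNgt; apply/negP => small.
  (* At most [k] good tents among [2k + 2] leave [k + 2] bad ones, one more than needed, so their
     energies sum to strictly more than that of [f]. *)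
  have big_C : (k.+2 <= #|~: J|)%N.
    have cardCJ : (#|J| + #|~: J|)%N = k.+1.*2 := etrans (cardsC J) (card_ord _).
    by rewrite -(leq_add2l #|J|) cardCJ -[X in (_ <= X)%N]addnn addnS -addSn leq_add2r.
  have : \sum_(i in ~: J) E i <= energy w f.
    apply: le_trans sumE; rewrite big_mkcond; apply: ler_sum => i _.
    by case: ifP => // _; apply: energy_ge0.
  apply/negP; rewrite -ltNge.
  apply: (@lt_le_trans _ _ (\sum_(i in ~: J) energy w f / k.+1%:R)); last first.
    by apply: ler_sum => i; rewrite !inE -ltNge => /ltW.
  rewrite sumr_const -[X in _ < X]mulr_natl mulrCA -[X in X < _]mulr1 ltr_pM2l //.
  by rewrite ltr_pdivlMr ?ltr0n // mul1r ltr_nat.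
pose h (i : 'I_k.+1) := enum_val (widen_ord card_J i).
have h_inj : injective h.
  by move=> i j /enum_val_inj/(congr1 val) /= ij; apply: val_inj.
apply: (@disjoint_functions_eigenvalue k (fun i v => g (h i) (f v))) => //.
- by move=> i j v ij; apply: g_disj; rewrite ?ltn_ord // val_eqE (inj_eq h_inj).
- by move=> i; apply: lt_le_trans (g_mass _ (ltn_ord _)).
- move=> i; have := enum_valP (widen_ord card_J i); rewrite inE => Ei.
  apply: le_trans Ei _; set m := mass _ _.
  have -> : energy w f / (k.+1%:R * C) * m = energy w f / k.+1%:R * (m / C).
    by rewrite invfM !mulrA mulrAC.
  apply: ler_peMr; first by rewrite divr_ge0 // ltW.
  by rewrite ler_pdivlMr // mul1r; apply: g_mass (ltn_ord _).
Qed.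

Lemma young (x y t : R) : 0 < t -> x * y <= t / 2 * x ^+ 2 + y ^+ 2 / (2 * t).
Proof.
move=> t_gt0; rewrite -subr_ge0.
have -> : t / 2 * x ^+ 2 + y ^+ 2 / (2 * t) - x * y = (t * x - y) ^+ 2 / (2 * t).
  by field; rewrite gt_eqF.
by rewrite divr_ge0 ?sqr_ge0 // mulr_ge0 ?ltW.
Qed.

(** The coarea inequality is applied to [h (f v)]. Young's inequality with the free parameter [t]
    weighs the energy against the threshold error. *)
Lemma profile_conductance (f : 'I_n -> R) (c : R) (m : nat) (h mu : R -> R) (t : R) :
  (forall v, 0 <= f v) -> (forall v, f v <= c) ->
  2 * vol w [set v | 0 < f v] <= vol w setT -> profile 0 c m h mu ->
  0 < t -> 0 <= graph_conductance w ->
  2 * (graph_conductance w * mass w f) <= 4 * m%:R *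
    ((1 + t / 2) * energy w f + (\sum_v wdeg w v * mu (f v) ^+ 2) / t).
Proof.
move=> f_ge0 f_le f_half [h0 mu0 mu_ge0 hP h_low] t_gt0 phi_ge0.
have h_ge0 v : 0 <= h (f v).
  by have [] := hP 0 (f v) (lexx 0) (f_ge0 v) (f_le v); rewrite h0 subr0.
have h_half : 2 * vol w [set v | 0 < h (f v)] <= vol w setT.
  apply: le_trans f_half; rewrite ler_pM2l //; apply: (vol_subset wdeg_ge1).
  apply/subsetP => v; rewrite !inE [0 < f v]lt_def f_ge0 andbT.
  by apply: contraTneq => ->; rewrite h0 ltxx.
have mass_le : mass w f <= 4 * m%:R * \sum_v wdeg w v * h (f v).
  rewrite mulr_sumr; apply: ler_sum => v _; rewrite [X in _ <= X]mulrCA.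
  apply: ler_wpM2l; first exact: ltW.
  by have := h_low (f v) (f_ge0 v) (f_le v); rewrite subr0.
(* Only [mu] at the smaller value is needed; adding the other term makes the bound symmetric in [u]
   and [v]. *)
have pointwise u v : `|h (f u) - h (f v)| <= (1 + t / 2) * (f u - f v) ^+ 2
    + (mu (f u) ^+ 2 + mu (f v) ^+ 2) / (2 * t).
  wlog uv : u v / f u <= f v.
    move=> H; case: (leP (f u) (f v)) => [/H//|/ltW/H].
    by rewrite distrC -[(f v - f u) ^+ 2]sqrrN opprB [mu (f v) ^+ 2 + _]addrC.
  have [d_ge0 d_le] := hP (f u) (f v) (f_ge0 u) uv (f_le v).
  rewrite distrC ger0_norm //; apply: le_trans d_le _.
  have := young (f v - f u) (mu (f u)) t_gt0.
  have : 0 <= mu (f v) ^+ 2 / (2 * t) by rewrite divr_ge0 ?sqr_ge0 // mulr_ge0 ?ltW.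
  by rewrite [(_ + _) / (2 * t)]mulrDl; nra.
have main := coarea w_graph wdeg_ge1 h_ge0 h_half.
apply: (@le_trans _ _ (4 * m%:R * (2 * (graph_conductance w * \sum_v wdeg w v * h (f v))))).
  rewrite [X in _ <= X]mulrCA [X in _ <= 2 * X]mulrCA ler_pM2l //.
  exact: ler_wpM2l.
apply: ler_wpM2l; first by rewrite mulr_ge0.
apply: le_trans main _.
have -> : (\sum_v wdeg w v * mu (f v) ^+ 2) / t =
    \sum_u \sum_v w u v * (mu (f u) ^+ 2 / (2 * t)) + \sum_u \sum_v w u v * (mu (f v) ^+ 2 / (2 * t)).
  rewrite (sum_wdeg w (fun u => mu (f u) ^+ 2 / (2 * t))).
  rewrite (sum_wdegr w_graph (fun u => mu (f u) ^+ 2 / (2 * t))).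
  rewrite -big_split mulr_suml; apply: eq_bigr => v _ /=.
  by field; rewrite gt_eqF.
rewrite mulr_sumr -!big_split; apply: ler_sum => u _ /=.
rewrite mulr_sumr -!big_split; apply: ler_sum => v _ /=.
by rewrite mulrCA -!mulrDr -mulrDl ler_wpM2l.
Qed.

Lemma improved_cheeger (k : nat) : (1 < n)%N -> (k < n)%N -> 0 < s`_k ->
  graph_conductance w <= 80 * k.+1%:R * s`_1 / Num.sqrt s`_k.
Proof.
move=> n_gt1 lt_kn; set lam := s`_k; set K : R := k.+1%:R => lam_gt0.
have K_gt0 : 0 < K by rewrite ltr0n.
have KE : k.+1%:R = K by []; clearbody K.
have [f [f_ge0 f_half f_gt0 f_le]] := test_function n_gt1.
set r := Num.sqrt lam; have r_gt0 : 0 < r by rewrite sqrtr_gt0.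
have rr : r ^+ 2 = lam by rewrite sqr_sqrtr ?ltW.
clearbody r; have r_le2 : r <= 2.
  rewrite -(@ler_pXn2r _ 2) ?nnegrE ?(ltW r_gt0) // rr.
  by apply: le_trans (eigenvalue_le2 lt_kn) _; rewrite -natrX ler_nat.
have s1_ge0 : 0 <= s`_1.
  by have := le_trans (energy_ge0 w_graph f) f_le; rewrite pmulr_lge0 // pmulr_rge0.
have rhs_ge0 : 0 <= 80 * K * s`_1 / r by rewrite !mulr_ge0 ?invr_ge0 // ltW.
have [phi_le0|phi_gt0] := leP (graph_conductance w) 0; first exact: le_trans phi_le0 rhs_ge0.
(* Zero energy makes [f] constant along edges, and the coarea inequality for [f] itself then
   contradicts positive conductance. This also disposes of a vanishing second eigenvalue. *)
have E_gt0 : 0 < energy w f.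
  rewrite lt_def energy_ge0 // andbT; apply: contraTneq phi_gt0 => E0.
  have [v fv_neq0] : exists v, f v != 0.
    apply/existsP; apply: contraTT f_gt0; rewrite negb_exists => /forallP f0.
    rewrite /mass big1 ?ltxx // => v _; have /negPn/eqP -> := f0 v.
    by rewrite expr0n mulr0.
  have sum_gt0 : 0 < \sum_v wdeg w v * f v.
    rewrite (bigD1 v) //=; apply: ltr_wpDr.
      by apply: sumr_ge0 => u _; rewrite mulr_ge0 // ltW.
    by rewrite mulr_gt0 // lt_def fv_neq0 f_ge0.
  have := coarea w_graph wdeg_ge1 f_ge0 f_half; rewrite -leNgt [X in _ <= X]big1.
    by rewrite pmulr_rle0 // pmulr_lle0.
  move=> u _; apply: big1 => x _; apply/eqP.
  move/eqP: E0; rewrite psumr_eq0 => [/allP/(_ u (mem_index_enum u))/=|y _]; last first.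
    by apply: sumr_ge0 => z _; rewrite mulr_ge0 ?sqr_ge0.
  rewrite psumr_eq0 => [/allP/(_ x (mem_index_enum x))/=|y _]; last by rewrite mulr_ge0 ?sqr_ge0.
  by rewrite mulf_eq0 sqrf_eq0 => ?; rewrite mulf_eq0 normr_eq0.
set E := energy w f in E_gt0 f_le *.
(* Chosen so that [2 * K] tents of mass at least [C] would force [lam <= lam / 2]. *)
pose C := 2 * E / (K * lam).
have C_gt0 : 0 < C by rewrite divr_gt0 ?mulr_gt0.
case: (@arg_maxP _ _ _ (Ordinal n_gt1) predT f isT) => v0 _ v0_max.
have f_le_max v : f v <= f v0 by apply: v0_max.
have := @tents_or_profile R n (wdeg w) f C (f v0) k.+1.*2 0 (fun v => ltW (wdeg_gt0 v))
  C_gt0 (ex_intro _ v0 erefl) f_le_max (f_ge0 v0).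
case=> [[g g_tents g_mass]|[h [mu [hmu err]]]].
  exfalso; have := tents_eigenvalue lt_kn C_gt0 E_gt0 g_tents g_mass.
  have -> : energy w f / (k.+1%:R * C) = lam / 2.
    by rewrite -/E KE /C; field; rewrite !gt_eqF.
  rewrite -/lam; lra.
have mu0 : mu 0 = 0 by case: hmu.
have {}err : \sum_v wdeg w v * mu (f v) ^+ 2 <= 4 * E / lam.
  apply: le_trans (_ : k.+1.*2%:R * C <= _).
    apply: le_trans err; rewrite [X in _ <= X]big_mkcond; apply: ler_sum => v _.
    case: ifP => // /negbT; rewrite lt_def f_ge0 andbT negbK => /eqP ->.
    by rewrite mu0 expr0n mulr0.
  have -> : 4 * E / lam = 2 * K * C by rewrite /C; field; rewrite !gt_eqF.
  by rewrite -muln2 natrM KE [K * 2]mulrC.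
(* With [t = 2 / r], the terms from [t / 2] and from the error are at most [E / r] and [2 * E / r];
   the remaining [E] is at most [2 * E / r] because [r <= 2]. The total is [5 * E / r]. *)
have t_gt0 : 0 < 2 / r by rewrite divr_gt0.
have main := profile_conductance f_ge0 f_le_max f_half hmu t_gt0 (ltW phi_gt0).
have bound : (1 + 2 / r / 2) * E + (\sum_v wdeg w v * mu (f v) ^+ 2) / (2 / r) <= 5 * E / r.
  have -> : 5 * E / r = (2 / r + 2 / r / 2) * E + (4 * E / lam) / (2 / r).
    by rewrite -rr; field; rewrite !gt_eqF.
  apply: lerD; last by apply: ler_wpM2r => //; rewrite invr_ge0 ltW.
  by rewrite ler_pM2r // lerD2r ler_pdivlMr // mul1r.
(* The profile has [4 * K] gaps. The final constant 80 is half of [16 * 5 * 2]. *)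
have m_eq : 4 * k.+1.*2.*2%:R = 16 * K by rewrite -!muln2 !natrM KE; ring.
rewrite -(ler_pM2r f_gt0) -(@ler_pM2l _ 2) //; apply: le_trans main _.
rewrite -/E m_eq; apply: (@le_trans _ _ (16 * K * (5 * E / r))).
  by rewrite ler_wpM2l ?mulr_ge0 ?(ltW K_gt0).
apply: (@le_trans _ _ (16 * K * (5 * (2 * s`_1 * mass w f) / r))).
  by rewrite ler_wpM2l ?mulr_ge0 ?(ltW K_gt0) // ler_wpM2r ?invr_ge0 ?(ltW r_gt0) // ler_wpM2l.
by rewrite le_eqVlt; apply/orP; left; apply/eqP; field; rewrite gt_eqF.
Qed.

End ImprovedCheeger.

(* lambda_j = s`_(j.-1) (eigenvalues are 1-indexed in the paper) *)
Theorem theorem1p1 :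
  exists C : nat, (0 < C)%N /\
  forall (R : rcfType) (n : nat) (w : 'I_n -> 'I_n -> R),
    is_wgraph w ->
    (forall v, 1 <= wdeg w v) ->
    forall s : seq R, sorted_spectrum (nlaplacian w) s ->
    forall k : nat, (2 <= k <= n)%N -> 0 < s`_k.-1 ->
      graph_conductance w <= C%:R * k%:R * s`_1 / Num.sqrt (s`_k.-1).
Proof.
exists 80%N; split=> // R n w w_graph wdeg_ge1 s spec [//|k] /andP[k_gt1 le_kn] lam_gt0.
exact: (improved_cheeger w_graph wdeg_ge1 spec (leq_trans k_gt1 le_kn) le_kn lam_gt0).
Qed.
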